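(* Let $S_{rt}$ denote the free solvable group of rank $r$ and class (derived length) $t$. Then: 1) for every integer $t\geq 2$, the group $S_{2t}$ satisfies the $R_\infty$ property (in particular, the free metabelian group $M_2=S_{22}$ of rank $2$ does); 2) for every integer $t\geq 4$, the group $S_{3t}$ satisfies the $R_\infty$ property; 3) for all integers $r\geq 4$ and $t\geq \log_2(2r+1)$, the group $S_{rt}$ satisfies the $R_\infty$ property.
   Context: The free solvable group $S_{rt}$ of rank $r$ and class $t$ is $F_r/F_r^{(t)}$, where $F_r$ is the free group of rank $r$ and $F_r^{(t)}$ is the $t$-th term of its derived series ($F_r^{(0)}=F_r$, $F_r^{(i+1)}=[F_r^{(i)},F_r^{(i)}]$). Automorphisms are written on the right: $x\varphi$ is the image of $x$ under $\varphi$. For a group $G$ and an automorphism $\varphi$ of $G$, elements $g,f\in G$ are $\varphi$-twisted conjugate if there exists $x\in G$ with $(x\varphi)g = fx$. This is an equivalence relation; the Reidemeister number $R(\varphi)$ is the number of its equivalence classes, with $R(\varphi)=\infty$ if there are infinitely many. A group $G$ has the $R_\infty$ property if $R(\varphi)=\infty$ for every automorphism $\varphi$ of $G$. *)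

(* Defs.v *)
From HB Require Import structures.
From mathcomp Require Import all_boot all_order all_algebra.
From mathcomp Require Import boolp classical_sets functions cardinality.
From mathcomp Require Import reals exp.

Set Implicit Arguments.
Unset Strict Implicit.
Unset Printing Implicit Defensive.

Local Open Scope classical_set_scope.
Local Open Scope group_scope.

(* The free group on X: reduced words in the letters (x, true), standing for  *)
(* x, and (x, false), standing for x^-1; the product of u and v is the        *)
(* reduction of the concatenation u ++ v.                                     *)
Section FreeGroup.
Variable X : choiceType.
Implicit Types (a b : X * bool) (u v w : seq (X * bool)).

Definition flip a := (a.1, ~~ a.2).

Definition reduced w := sorted (fun a b => b != flip a) w.

Definition push a w := if w is b :: w' then
  if b == flip a then w' else a :: w else [:: a].

Definition reduce_onto w u := foldr push w u.

Lemma flipK : involutive flip.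
Proof. by case=> x e; rewrite /flip /= negbK. Qed.

Lemma push_reduced a w : reduced w -> reduced (push a w).
Proof.
case: w => [//|b w] /= ew; case: ifP => [_|nba]; first exact: path_sorted ew.
by rewrite /= nba.
Qed.

Lemma push_flipK a w : reduced w -> push a (push (flip a) w) = w.
Proof.
case: w => [|b w] /= ew; first by rewrite eqxx.
rewrite flipK; case: eqP => [ba|_] /=; last by rewrite eqxx.
by subst b; case: w ew => [//|c w] /= /andP[/negPf->].
Qed.

Lemma reduce_onto_reduced w u : reduced w -> reduced (reduce_onto w u).
Proof. by move=> rw; elim: u => //= a u; apply: push_reduced. Qed.

Lemma reduce_onto_push w a u :
  reduced w -> reduce_onto w (push a u) = push a (reduce_onto w u).
Proof.
move=> rw; case: u => //= b u; case: eqP => [->|//].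
by rewrite push_flipK // reduce_onto_reduced.
Qed.

Lemma reduce_onto_comp w v u : reduced w ->
  reduce_onto w (reduce_onto v u) = reduce_onto (reduce_onto w v) u.
Proof. by move=> rw; elim: u => //= a u <-; rewrite reduce_onto_push. Qed.

Lemma reduce_id w : reduced w -> reduce_onto [::] w = w.
Proof.
elim: w => //= a w IHw raw; rewrite (IHw (path_sorted raw)).
by case: w raw {IHw} => //= b w /andP[/negPf->].
Qed.

Record free_group := FreeGroup { word :> seq (X * bool); _ : reduced word }.

HB.instance Definition _ := [isSub of free_group for word].
HB.instance Definition _ := [Choice of free_group by <:].

Lemma word_reduced (g : free_group) : reduced g. Proof. exact: valP. Qed.

Definition free_one := @FreeGroup [::] isT.

Definition free_mul (g h : free_group) :=
  FreeGroup (reduce_onto_reduced g (word_reduced h)).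

Lemma inv_word_reduced (g : free_group) : reduced (rev (map flip g)).
Proof.
rewrite /reduced rev_sorted sorted_map; apply: sub_sorted (word_reduced g).
by move=> a b /=; apply: contra; rewrite flipK => /eqP->.
Qed.

Definition free_inv g := FreeGroup (inv_word_reduced g).

Lemma free_mulA : associative free_mul.
Proof.
move=> g h k; apply: val_inj; rewrite /= reduce_onto_comp //.
exact: word_reduced.
Qed.

Lemma free_mul1g : left_id free_one free_mul.
Proof. by move=> g; apply: val_inj. Qed.

Lemma free_mulg1 : right_id free_one free_mul.
Proof. by move=> g; apply: val_inj; rewrite /= reduce_id ?word_reduced. Qed.

Lemma reduce_inv_word w u : reduced w ->
  reduce_onto (reduce_onto w u) (rev (map flip u)) = w.
Proof.
move=> rw; elim: u => //= a u IHu; rewrite rev_cons -cats1 /reduce_onto.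
rewrite foldr_cat /= -{2}(flipK a) push_flipK ?IHu //.
exact: reduce_onto_reduced.
Qed.

Lemma free_mulVg : left_inverse free_one free_inv free_mul.
Proof.
move=> g; apply: val_inj => /=.
by rewrite -{1}(reduce_id (word_reduced g)) reduce_inv_word.
Qed.

Lemma free_invK : involutive free_inv.
Proof.
move=> g; apply: val_inj => /=.
by rewrite map_rev revK -map_comp map_id_in // => a _; apply: flipK.
Qed.

Lemma free_mulgV : right_inverse free_one free_inv free_mul.
Proof. by move=> g; rewrite -{1}[g]free_invK free_mulVg. Qed.

HB.instance Definition _ := isGroup.Build free_group
  free_mulA free_mul1g free_mulg1 free_mulVg free_mulgV.

Definition free_gen (x : X) : free_group := @FreeGroup [:: (x, true)] isT.

End FreeGroup.

Section FreeGroupUniversal.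
Variables (X : choiceType) (H : groupType) (f : X -> H).

Definition letter_val (a : X * bool) : H := if a.2 then f a.1 else (f a.1)^-1.

Definition free_lift (g : free_group X) : H :=
  foldr (fun a h => letter_val a * h) 1 g.

Lemma free_liftM : {morph free_lift : g h / g * h}.
Proof.
have valV a : letter_val (flip a) = (letter_val a)^-1.
  by case: a => x [] //=; rewrite /letter_val /= invgK.
move=> g h; rewrite /free_lift [word (g * h)]/=.
elim: (word g) => [|a u IHu] /=; first by rewrite mul1g.
rewrite -mulgA -IHu; case: (reduce_onto _ _) => [//|b w] /=.
by case: eqP => [->|//]; rewrite valV mulVKg.
Qed.

Lemma free_lift_gen x : free_lift (free_gen x) = f x.
Proof. exact: mulg1. Qed.

Lemma free_lift_unique (phi : {multiplicative free_group X -> H}) :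
  (forall x, phi (free_gen x) = f x) -> phi =1 free_lift.
Proof.
have phi1 : phi 1 = 1 by apply: (mulgI (phi 1)); rewrite -gmulfM !mulg1.
have phiV g : phi g^-1 = (phi g)^-1.
  by apply: (mulgI (phi g)); rewrite -gmulfM !mulgV.
move=> phiE [w rw]; rewrite /free_lift /=.
elim: w rw => [|[x e] w IHw] rw.
  by rewrite -phi1; congr (phi _); exact: val_inj.
have rw' : reduced w := path_sorted rw.
have -> : FreeGroup rw =
    (if e then free_gen x else (free_gen x)^-1) * FreeGroup rw'.
  apply: val_inj; case: e rw => rw /=;
  by case: (w) rw => //= b v /andP[/negPf->].
rewrite gmulfM IHw /letter_val /=; congr (_ * _).
by case: e {rw}; rewrite ?phiV phiE.
Qed.

End FreeGroupUniversal.

Definition subgroup (G : groupType) (H : set G) :=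
  H 1 /\ forall x y, H x -> H y -> H (x / y).

Definition generated (G : groupType) (A : set G) : set G :=
  smallest (@subgroup G) A.

Definition commutator_subgroup (G : groupType) (H K : set G) : set G :=
  generated [set [~ x, y] | x in H & y in K].

Fixpoint derived_series (G : groupType) (n : nat) : set G :=
  if n is m.+1 then
    commutator_subgroup (derived_series m) (derived_series m)
  else setT.
Arguments derived_series G n : clear implicits.

Definition conj_closed (G : groupType) (H : set G) :=
  forall x y, H x -> H (x ^ y).

Record normal_subgroup (G : groupType) := NormalSubgroup {
  normal_set : set G;
  normal_set_subgroup : subgroup normal_set;
  normal_set_conj_closed : conj_closed normal_set }.

Section Generated.
Variable G : groupType.
Implicit Types A : set G.

Lemma generated_subgroup A : subgroup (generated A).
Proof.
split=> [B [[]] //|x y Ax Ay B BA]; case: (BA) => [[_ divB] _].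
by apply: divB; [exact: Ax | exact: Ay].
Qed.

Lemma generated_conj_closed A : conj_closed A -> conj_closed (generated A).
Proof.
move=> cA x y Ax; have [g1 gF] := generated_subgroup A.
apply: (Ax [set z | generated A (z ^ y)]); split=> [|z Az /=]; last first.
  by apply: sub_gen_smallest; exact: cA.
split=> /= [|u v gu gv]; first by rewrite conj1g.
by rewrite conjMg conjVg; apply: gF.
Qed.

Lemma derived_series_subgroup n : subgroup (derived_series G n).
Proof. by case: n => [//|n]; exact: generated_subgroup. Qed.

Lemma derived_series_conj_closed n : conj_closed (derived_series G n).
Proof.
elim: n => [//|n IHn]; apply: generated_conj_closed => z y [u Du [v Dv <-]].
by rewrite conjRg; exists (u ^ y); [exact: IHn | exists (v ^ y); [exact: IHn|]].
Qed.

End Generated.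

Definition derived_normal (G : groupType) (n : nat) : normal_subgroup G :=
  NormalSubgroup (@derived_series_subgroup G n)
                 (@derived_series_conj_closed G n).

Section Quotient.
Variables (G : groupType) (N : normal_subgroup G).

Let N1 : normal_set N 1. Proof. exact: (normal_set_subgroup N).1. Qed.
Let NF x y : normal_set N x -> normal_set N y -> normal_set N (x / y).
Proof. exact: (normal_set_subgroup N).2. Qed.
Let NJ x y : normal_set N x -> normal_set N (x ^ y).
Proof. exact: normal_set_conj_closed. Qed.
Let NV x : normal_set N x -> normal_set N x^-1.
Proof. by move=> Nx; rewrite -[x^-1]mul1g; apply: NF. Qed.
Let NM x y : normal_set N x -> normal_set N y -> normal_set N (x * y).
Proof. by move=> Nx Ny; rewrite -[y]invgK; apply/NF => //; apply: NV. Qed.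

Definition coset_eq (x y : G) : bool := `[< normal_set N (x^-1 * y) >].

Lemma coset_eq_refl : reflexive coset_eq.
Proof. by move=> x; apply/asboolP; rewrite mulVg. Qed.

Lemma coset_eq_sym : symmetric coset_eq.
Proof.
by move=> x y; apply/asboolP/asboolP => /NV; rewrite invgM invgK.
Qed.

Lemma coset_eq_trans : transitive coset_eq.
Proof.
move=> y x z /asboolP Nxy /asboolP Nyz; apply/asboolP.
by have := NM Nxy Nyz; rewrite mulgA mulgK.
Qed.

Canonical coset_equiv :=
  EquivRel coset_eq coset_eq_refl coset_eq_sym coset_eq_trans.

Definition quotient_group := {eq_quot coset_equiv}%qT.

HB.instance Definition _ := Choice.on quotient_group.
HB.instance Definition _ := EqQuotient.on quotient_group.

Definition quotient_map (x : G) : quotient_group := (\pi_(quotient_group) x)%qT.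

Lemma quotient_mapP x y :
  reflect (quotient_map x = quotient_map y) (coset_eq x y).
Proof. exact: eqquotP. Qed.

Lemma quotient_reprK a : quotient_map (repr a) = a.
Proof. exact: reprK. Qed.

Lemma quotient_ind (P : quotient_group -> Prop) :
  (forall x, P (quotient_map x)) -> forall a, P a.
Proof. by move=> Pq a; rewrite -[a]quotient_reprK. Qed.

Definition quotient_one : quotient_group := quotient_map 1.
Definition quotient_mul (a b : quotient_group) : quotient_group :=
  quotient_map (repr a * repr b).
Definition quotient_inv (a : quotient_group) : quotient_group :=
  quotient_map (repr a)^-1.

Lemma repr_quotient_map x : coset_eq (repr (quotient_map x)) x.
Proof. by apply/quotient_mapP; rewrite quotient_reprK. Qed.

Lemma quotient_mulE x y :
  quotient_mul (quotient_map x) (quotient_map y) = quotient_map (x * y).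
Proof.
apply/quotient_mapP/asboolP; have /asboolP Nx := repr_quotient_map x.
have /asboolP Ny := repr_quotient_map y.
have := NM (NJ (repr (quotient_map y)) Nx) Ny.
by rewrite /conjg invgM !mulgA mulgK.
Qed.

Lemma quotient_invE x : quotient_inv (quotient_map x) = quotient_map x^-1.
Proof.
apply/quotient_mapP/asboolP; have /asboolP/(NJ x^-1)/NV := repr_quotient_map x.
by rewrite /conjg !(invgM, invgK) !mulgA mulgV mul1g; congr (normal_set N _);
   rewrite -mulgA.
Qed.

Lemma quotient_mulA : associative quotient_mul.
Proof.
by elim/quotient_ind=> x; elim/quotient_ind=> y; elim/quotient_ind=> z;
   rewrite !quotient_mulE mulgA.
Qed.

Lemma quotient_mul1g : left_id quotient_one quotient_mul.
Proof. by elim/quotient_ind=> x; rewrite quotient_mulE mul1g. Qed.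

Lemma quotient_mulg1 : right_id quotient_one quotient_mul.
Proof. by elim/quotient_ind=> x; rewrite quotient_mulE mulg1. Qed.

Lemma quotient_mulVg : left_inverse quotient_one quotient_inv quotient_mul.
Proof. by elim/quotient_ind=> x; rewrite quotient_invE quotient_mulE mulVg. Qed.

Lemma quotient_mulgV : right_inverse quotient_one quotient_inv quotient_mul.
Proof. by elim/quotient_ind=> x; rewrite quotient_invE quotient_mulE mulgV. Qed.

HB.instance Definition _ := isGroup.Build quotient_group
  quotient_mulA quotient_mul1g quotient_mulg1 quotient_mulVg quotient_mulgV.

Lemma quotient_mapM : {morph quotient_map : x y / x * y}.
Proof. by move=> x y; rewrite -quotient_mulE. Qed.

Lemma quotient_map_eq1 x : quotient_map x = 1 <-> normal_set N x.
Proof.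
by split=> [/esym/quotient_mapP/asboolP|Nx]; rewrite ?(invg1, mul1g) //;
   apply/esym/quotient_mapP/asboolP; rewrite invg1 mul1g.
Qed.

End Quotient.

Definition free_solvable (r t : nat) : groupType :=
  quotient_group (derived_normal (free_group 'I_r) t).

Definition twisted_conjugate (G : groupType) (phi : G -> G) (g f : G) :=
  exists x, phi x * g = f * x.

Definition twisted_class (G : groupType) (phi : G -> G) (f : G) : set G :=
  [set g | twisted_conjugate phi g f].

Definition twisted_classes (G : groupType) (phi : G -> G) : set (set G) :=
  range (twisted_class phi).

(* R(phi) = oo is rendered as infiniteness of the set of twisted conjugacy    *)
(* classes of phi; an automorphism is a bijective endomorphism.               *)
Definition R_infinity (G : groupType) :=
  forall phi : {multiplicative G -> G}, bijective phi ->
    infinite_set (twisted_classes phi).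

Section TwistedConjugacy.
Variables (G : groupType) (phi : {multiplicative G -> G}).

Let phi1 : phi 1 = 1.
Proof. by apply: (mulgI (phi 1)); rewrite -gmulfM !mulg1. Qed.

Lemma twisted_conjugate_refl g : twisted_conjugate phi g g.
Proof. by exists 1; rewrite phi1 mulg1 mul1g. Qed.

Lemma twisted_conjugate_sym g f :
  twisted_conjugate phi g f -> twisted_conjugate phi f g.
Proof.
case=> x xgf; exists x^-1; apply: (mulgI (phi x)).
by rewrite !mulgA -gmulfM mulgV phi1 mul1g xgf mulgK.
Qed.

Lemma twisted_conjugate_trans g f h :
  twisted_conjugate phi g f -> twisted_conjugate phi f h ->
  twisted_conjugate phi g h.
Proof.
move=> [x xgf] [y yfh]; exists (y * x).
by rewrite gmulfM -mulgA xgf mulgA yfh mulgA.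
Qed.

End TwistedConjugacy.

Definition log2 (R : realType) (x : R) : R := (ln x / ln 2%:R)%R.

(* Main.v *)
Require Import Defs.
From mathcomp Require Import all_boot all_order all_algebra all_field.
From mathcomp Require Import boolp classical_sets cardinality.
From mathcomp Require Import reals exp.
From mathcomp Require Import ring zify.

Set Implicit Arguments.
Unset Strict Implicit.
Unset Printing Implicit Defensive.

Import Order.TTheory GRing.Theory Num.Theory.
Local Open Scope ring_scope.

(** Let F be free of rank r >= 2 and let D_n be its n-th dimension subgroup.  The
    group F / N has property R_infinity as soon as N is contained in D_(2r+1)
    (R_infinity_quotient).

    Let phi be an automorphism of F / N, lifted to an endomorphism of F, and let
    A be its matrix on the abelianization; A is invertible over the integers, so
    (det A)^2 = 1.  On D_n / D_(n+1), a lattice in the degree n part of the free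
    Lie algebra, phi acts by the n-th tensor power of A.  If v_1, ..., v_r is a
    basis of eigenvectors of A with eigenvalues a_1, ..., a_r, a Lie monomial
    containing every v_i exactly twice is an eigenvector with eigenvalue
    (a_1 ... a_r)^2 = 1, and there is a nonzero one, in degree 2r.  (When A is only
    triangularizable, the same argument works modulo lower terms.)

    Hence there is a least n <= 2r for which phi has eigenvalue 1 on the
    complexification of D_n / D_(n+1), and so there is a nonzero homomorphism h
    from D_n to the complex numbers, trivial on D_(n+1), with h o phi = h.  If x
    satisfies (phi x) x^-1 in D_n, then x is in D_n, because eigenvalue 1 does not
    occur in smaller degrees.  So if z, z' in D_n are twisted conjugate by x then
    h z = h z', and the powers of an element with h != 0 lie in distinct twisted
    classes (twisted_separation).

    To avoid Lie algebras and completed group rings, everything is phrased dually,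
    through polynomial functions on F: those annihilated by n differences have
    degree less than n, and D_n consists of the elements that no such function
    distinguishes from 1.  Functions of degree at most n are spanned modulo lower
    degree by the Magnus coefficients of the words of length n (degree_lt_span),
    and the Lie monomial above becomes a linear form on combinations of words
    (bracket).  The linear algebra is replaced by an induction on the triangular
    order of words (magnus_coboundary).

    It remains to see that F^(t) lies in D_(2r+1).  From [D_i, D_j] in D_(i+j) one
    gets F^(t) in D_(2^t) (derived_sub_dim), which suffices when 2r+1 <= 2^t.  For
    r = t = 2 this only gives D_4, and the missing step comes from the
    one-dimensionality of the degree 2 part of the free Lie algebra of rank 2
    (derived2_sub_dim5). *)

(** * Polynomial functions on a group and dimension subgroups *)

Section PolynomialFunctions.
Variables (G : groupType) (C : fieldType).
Implicit Types (f g : G -> C) (x y z w : G).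

Definition ldiff w f x : C := f (w * x)%g - f x.
Definition rdiff w f x : C := f (x * w)%g - f x.

Fixpoint degree_lt n f : Prop :=
  if n is m.+1 then forall w, degree_lt m (ldiff w f) else forall x, f x = 0.

Lemma degree_lt_ext n f g : f =1 g -> degree_lt n f -> degree_lt n g.
Proof. by move=> /funext ->. Qed.

Lemma degree_lt0 n : degree_lt n (fun=> 0).
Proof.
elim: n => //= n IHn w; apply: degree_lt_ext IHn => x.
by rewrite /ldiff subrr.
Qed.

Lemma degree_ltZD n a f g :
  degree_lt n f -> degree_lt n g -> degree_lt n (fun x => a * f x + g x).
Proof.
elim: n f g => [|n IHn] f g /= Pf Pg => [x|w].
  by rewrite Pf Pg mulr0 addr0.
by apply: degree_lt_ext (IHn _ _ (Pf w) (Pg w)) => x; rewrite /ldiff; ring.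
Qed.

Lemma degree_ltD n f g :
  degree_lt n f -> degree_lt n g -> degree_lt n (fun x => f x + g x).
Proof.
move=> Pf Pg; apply: degree_lt_ext (degree_ltZD 1 Pf Pg) => x.
by rewrite mul1r.
Qed.

Lemma degree_ltZ n a f : degree_lt n f -> degree_lt n (fun x => a * f x).
Proof.
move=> Pf; apply: degree_lt_ext (degree_ltZD a Pf (degree_lt0 n)) => x.
by rewrite addr0.
Qed.

Lemma degree_ltB n f g :
  degree_lt n f -> degree_lt n g -> degree_lt n (fun x => f x - g x).
Proof.
move=> Pf Pg; apply: degree_lt_ext (degree_ltZD (-1) Pg Pf) => x.
by rewrite mulN1r addrC.
Qed.

Lemma degree_lt_sum n (I : eqType) (s : seq I) (F : I -> G -> C) :
  (forall i, i \in s -> degree_lt n (F i)) ->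
  degree_lt n (fun x => \sum_(i <- s) F i x).
Proof.
elim: s => [|i s IHs] PF.
  by apply: degree_lt_ext (degree_lt0 n) => x; rewrite big_nil.
apply: degree_lt_ext (degree_ltD (PF i (mem_head i s)) (IHs _)) => [x|l sl].
  by rewrite big_cons.
by apply: PF; rewrite inE sl orbT.
Qed.

Lemma degree_ltW n f : degree_lt n f -> degree_lt n.+1 f.
Proof.
elim: n f => [|n IHn] f /= Pf w => [x|]; first by rewrite /ldiff !Pf subrr.
exact: IHn.
Qed.

Lemma degree_lt_leq m n f : (m <= n)%N -> degree_lt m f -> degree_lt n f.
Proof.
by move=> /subnK <- Pf; elim: (n - m)%N => // k; apply: degree_ltW.
Qed.

Lemma degree_lt_const a : degree_lt 1 (fun=> a).
Proof. by move=> w x; rewrite /ldiff subrr. Qed.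

Lemma ldiff_rdiff x y f : ldiff x (rdiff y f) = rdiff y (ldiff x f).
Proof. by apply/funext => z; rewrite /ldiff /rdiff mulgA; ring. Qed.

(** Left and right differences commute, so the degree of a function may be
    computed on either side; this is what makes the dimension subgroups below
    behave symmetrically. *)
Lemma degree_lt_rdiffP n f :
  degree_lt n.+1 f <-> forall w, degree_lt n (rdiff w f).
Proof.
elim: n f => [|n IHn] f.
  split=> [Pf w x|Pf w x]; apply/eqP; rewrite subr_eq0; apply/eqP.
    have /eqP := Pf (x * w * x^-1)%g x.
    by rewrite /ldiff mulgVK subr_eq0=> /eqP.
  have /eqP := Pf (x^-1 * w * x)%g x.
  by rewrite /rdiff -!mulgA mulVKg subr_eq0=> /eqP.
split=> [Pf w v|Pf w].
  by rewrite ldiff_rdiff; have /IHn := Pf v; apply.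
by apply/IHn => v; rewrite -ldiff_rdiff; apply: Pf.
Qed.

Lemma degree_lt_ltrans n f y :
  degree_lt n f -> degree_lt n (fun x => f (y * x)%g).
Proof.
case: n => [|n] Pf; first by move=> x; apply: Pf.
apply: degree_lt_ext (degree_ltD (degree_ltW (Pf y)) Pf) => x.
by rewrite /ldiff subrK.
Qed.

Lemma degree_lt_rtrans n f y :
  degree_lt n f -> degree_lt n (fun x => f (x * y)%g).
Proof.
case: n => [|n] Pf; first by move=> x; apply: Pf.
have /degree_lt_rdiffP Pf' := Pf.
apply: degree_lt_ext (degree_ltD (degree_ltW (Pf' y)) Pf) => x.
by rewrite /rdiff subrK.
Qed.

(** This is the n-th dimension subgroup over C, of those w such that w - 1 lies
    in I^n for the augmentation ideal I of the group algebra: the functions of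
    degree less than n are the linear forms on the group algebra that vanish on
    I^n.  Defined through functions, it is visibly preserved by every
    endomorphism. *)
Definition dimension_subgroup n w := forall f, degree_lt n f -> f w = f 1%g.
Local Notation D := dimension_subgroup.

Lemma dim_leq m n w : (m <= n)%N -> D n w -> D m w.
Proof. by move=> mn Dw f Pf; apply/Dw/(degree_lt_leq mn). Qed.

Lemma dim1 w : D 1 w.
Proof.
move=> f /(_ w 1%g)/eqP; rewrite /ldiff mulg1 subr_eq0.
by move/eqP.
Qed.

Lemma dim_one n : D n 1%g. Proof. by []. Qed.

Lemma dimM n x y : D n x -> D n y -> D n (x * y)%g.
Proof.
move=> Dx Dy f Pf.
by rewrite (Dx _ (degree_lt_rtrans y Pf)) mul1g Dy.
Qed.

Lemma dimV n x : D n x -> D n x^-1%g.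
Proof.
move=> Dx f Pf.
by have := Dx _ (degree_lt_rtrans x^-1%g Pf); rewrite mulgV mul1g.
Qed.

(** The left difference by w commutes with every right difference, so right
    differences reduce the claim to n = 0, where it is the definition of the
    dimension subgroup applied to a right translate of f. *)
Lemma ldiff_dim i n f w :
  D i w -> degree_lt (n + i) f -> degree_lt n (ldiff w f).
Proof.
move=> Dw; elim: n f => [|n IHn] f Pf.
  move=> x; apply/eqP; rewrite subr_eq0; apply/eqP.
  by rewrite (Dw _ (degree_lt_rtrans x Pf)) mul1g.
apply/degree_lt_rdiffP => v; rewrite -ldiff_rdiff; apply: IHn.
by have /degree_lt_rdiffP := Pf.
Qed.

Lemma rdiff_dim i n f w :
  D i w -> degree_lt (n + i) f -> degree_lt n (rdiff w f).
Proof.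
move=> Dw; elim: n f => [|n IHn] f Pf.
  move=> x; apply/eqP; rewrite subr_eq0; apply/eqP.
  by rewrite (Dw _ (degree_lt_ltrans x Pf)) mulg1.
by move=> v; rewrite ldiff_rdiff; apply: IHn; apply: Pf.
Qed.

(** The defect of additivity of f - f 1; for f of degree 2 it is the bilinear
    form attached to f. *)
Definition polarization f x y : C := f (x * y)%g - f x - f y + f 1%g.

Lemma polarizationEl f x y : polarization f x y = ldiff x f y - ldiff x f 1%g.
Proof. by rewrite /polarization /ldiff mulg1; ring. Qed.

Lemma polarizationEr f x y : polarization f x y = rdiff y f x - rdiff y f 1%g.
Proof. by rewrite /polarization /rdiff mul1g; ring. Qed.

Lemma polarization_dim i j f x y :
  D i x -> D j y -> degree_lt (i + j) f -> polarization f x y = 0.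
Proof.
rewrite addnC => Dx Dy Pf.
by rewrite polarizationEl (Dy _ (ldiff_dim Dx Pf)) subrr.
Qed.

Lemma dim_additive n f x y : (0 < n)%N -> D n x -> D n y -> degree_lt n.+1 f ->
  f (x * y)%g - f 1%g = (f x - f 1%g) + (f y - f 1%g).
Proof.
move=> n0 Dx Dy Pf.
have Pnn : degree_lt (n + n) f by apply: degree_lt_leq Pf; lia.
have := polarization_dim Dx Dy Pnn; rewrite /polarization => H.
by apply: subr0_eq; rewrite -[RHS]H; ring.
Qed.

(** Write [x, y] as v (x y) with v the inverse of y x, so that v (y x) = 1.
    Translating f by v changes it only by a function of lower degree, and the
    polarization of such a function vanishes on the pair (x, y); the left side
    is thus the antisymmetrization of the polarization of f itself. *)
Lemma commutator_leading i j f x y : D i x -> D j y -> degree_lt (i + j).+1 f ->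
  f [~ x, y]%g - f 1%g = polarization f x y - polarization f y x.
Proof.
move=> Dx Dy Pf.
pose v := ((y * x)^-1)%g; pose g z : C := f (v * z)%g.
have Pgf : degree_lt (i + j) (fun z => g z - f z) by apply: Pf.
have -> : [~ x, y]%g = (v * (x * y))%g by rewrite /v /commg /conjg invgM !mulgA.
have -> : f 1%g = g (y * x)%g by rewrite /g /v mulVg.
have E1 := polarization_dim Dx Dy Pgf; rewrite addnC in Pgf.
have E2 := polarization_dim Dy Dx Pgf.
move: E1 E2; rewrite -/(g (x * y)%g) /polarization => E1 E2.
by apply: subr0_eq; rewrite -[RHS]subr0 -{1}E1 -E2; ring.
Qed.

Lemma dim_commg i j x y : D i x -> D j y -> D (i + j) [~ x, y]%g.
Proof.
move=> Dx Dy f Pf; apply/eqP; rewrite -subr_eq0.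
rewrite (commutator_leading Dx Dy (degree_ltW Pf)) (polarization_dim Dx Dy) //.
by rewrite (polarization_dim Dy Dx) 1?addnC ?subrr.
Qed.

End PolynomialFunctions.
(** * Dimension subgroups, endomorphisms and the derived series *)

Section DimensionSubgroups.
Variables (G H : groupType) (C : fieldType).
Local Notation D := (dimension_subgroup C).

Lemma morph_one (phi : G -> H) : {morph phi : x y / (x * y)%g} -> phi 1%g = 1%g.
Proof. by move=> phiM; apply: (mulgI (phi 1%g)); rewrite -phiM !mulg1. Qed.

Lemma morph_inv (phi : G -> H) : {morph phi : x y / (x * y)%g} ->
  {morph phi : x / (x^-1)%g}.
Proof.
move=> phiM x; apply: (mulgI (phi x)).
by rewrite -phiM !mulgV morph_one.
Qed.

Lemma degree_lt_comp (phi : G -> H) n (f : H -> C) :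
  {morph phi : x y / (x * y)%g} -> degree_lt n f -> degree_lt n (f \o phi).
Proof.
move=> phiM; elim: n f => [|n IHn] f Pf => [x|w]; first exact: Pf.
by apply: degree_lt_ext (IHn _ (Pf (phi w))) => x; rewrite /ldiff /= phiM.
Qed.

Lemma dim_morph (phi : G -> H) n w :
  {morph phi : x y / (x * y)%g} -> D n w -> D n (phi w).
Proof.
move=> phiM Dw f Pf; have := Dw _ (degree_lt_comp phiM Pf).
by rewrite /= (morph_one phiM).
Qed.

Lemma dim_conj n (x y : G) : D n x -> D n (y * x * y^-1)%g.
Proof.
move=> Dx f Pf.
have := Dx _ (degree_lt_ltrans y (degree_lt_rtrans y^-1%g Pf)).
by rewrite /= mulg1 mulgV.
Qed.

Lemma generated_sub (A : set G) (P : G -> Prop) : P 1%g ->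
  (forall x y, P x -> P y -> P (x * y)%g) -> (forall x, P x -> P x^-1%g) ->
  (forall x, A x -> P x) -> forall x, generated A x -> P x.
Proof.
move=> P1 PM PV AP x gx; apply: (gx [set z | P z]%classic); split=> //.
by split=> // u v Pu Pv; apply: PM => //; apply: PV.
Qed.

Lemma derived_sub_dim n w : derived_series G n w -> D (2 ^ n) w.
Proof.
elim: n w => [|n IHn] w; first by move=> _; apply: dim1.
apply: generated_sub => [|x y|x|_ [x Dx [y Dy <-]]]; first exact: dim_one.
- exact: dimM.
- exact: dimV.
- by rewrite expnS mul2n -addnn; apply: dim_commg; apply: IHn.
Qed.

Lemma derived_series_leq m n w :
  (m <= n)%N -> derived_series G n w -> derived_series G m w.
Proof.
move=> /subnK <-; elim: (n - m)%N w => // k IHk w Dw; apply: IHk.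
have [D1 DF] := derived_series_subgroup G (k + m).
have DV x : derived_series G (k + m) x -> derived_series G (k + m) x^-1%g.
  by move=> Dx; rewrite -[x^-1%g]mul1g; apply: DF.
have DM x y : derived_series G (k + m) x -> derived_series G (k + m) y ->
    derived_series G (k + m) (x * y)%g.
  by move=> Dx Dy; rewrite -[y]invgK; apply: DF => //; apply: DV.
move: w Dw; apply: generated_sub => // _ [x Dx [y Dy <-]].
apply: DM; first exact: DV.
exact: derived_series_conj_closed.
Qed.

End DimensionSubgroups.

(** * Integration on a free group *)

Section FreeInduction.
Variable X : choiceType.
Local Notation F := (free_group X).
Local Notation gen := (@free_gen X).

Definition word_val (w : seq (X * bool)) : F :=
  foldr (fun a h => letter_val gen a * h)%g 1%g w.

Lemma word_valK (g : F) : word_val g = g.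
Proof.
by symmetry; apply: (free_lift_unique (f := gen) (phi := idfun)) => k.
Qed.

Lemma free_group_ind (P : F -> Prop) : P 1%g ->
  (forall k g, P g -> P (gen k * g)%g) ->
  (forall k g, P g -> P ((gen k)^-1 * g)%g) -> forall g, P g.
Proof.
move=> P1 PM PV g; rewrite -[g]word_valK.
elim: (word g) => [|[k e] w IHw] //=.
by case: e => /=; [apply: PM | apply: PV].
Qed.

Lemma free_morph_eq (H : groupType) (phi psi : F -> H) :
  {morph phi : x y / (x * y)%g} -> {morph psi : x y / (x * y)%g} ->
  (forall k, phi (gen k) = psi (gen k)) -> phi =1 psi.
Proof.
move=> phiM psiM E; elim/free_group_ind => [|k g IHg|k g IHg].
- by rewrite !morph_one.
- by rewrite phiM psiM E IHg.
- by rewrite phiM psiM !morph_inv // E IHg.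
Qed.

(** A function on a free group can be prescribed by its left differences at the
    free generators, arbitrarily and independently of one another; this is how
    freeness enters the construction of the Magnus coefficients. *)
Section Integral.
Variables (V : zmodType) (f : X -> F -> V).

Fixpoint word_integral (w : seq (X * bool)) : V :=
  if w is (k, e) :: w' then
    word_integral w' + if e then f k (word_val w') else - f k (word_val w)
  else 0.

Definition integral (g : F) : V := word_integral g.

Lemma integral_gen k g : integral (gen k * g)%g = integral g + f k g.
Proof.
rewrite /integral [word (_ * g)%g]/= /push -{4}[g]word_valK.
case: (word g) => [|[l e] w] //.
case: eqP => [[-> ->]|_] //.
by rewrite /= subrK.
Qed.

End Integral.
End FreeInduction.
(** * Magnus coefficients *)

Section Words.
Variables (r : nat) (C : fieldType).
Implicit Types (s t : seq 'I_r).

Fixpoint words n : seq (seq 'I_r) :=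
  if n is m.+1 then [seq k :: t | k <- enum 'I_r, t <- words m] else [:: [::]].

Lemma big_words_cons n (f : seq 'I_r -> C) :
  \sum_(t <- words n.+1) f t = \sum_k \sum_(t <- words n) f (k :: t).
Proof. by rewrite /= big_allpairs_dep big_enum. Qed.

Lemma big_words_rcons n (f : seq 'I_r -> C) :
  \sum_(t <- words n.+1) f t = \sum_k \sum_(t <- words n) f (rcons t k).
Proof.
elim: n f => [|n IHn] f.
  by rewrite big_words_cons; apply: eq_bigr => k _; rewrite /= !big_seq1.
rewrite big_words_cons; under eq_bigr do rewrite IHn.
rewrite exchange_big; apply: eq_bigr => k _.
by rewrite big_words_cons.
Qed.

Lemma mem_words n t : (t \in words n) = (size t == n).
Proof.
elim: n t => [|n IHn] [|k t] //=.
  by apply/negP => /allpairsP[[l t] []].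
rewrite eqSS -IHn; apply/allpairsP/idP => [[[l t'] [_ /= ? [_ ->]]] //|wt].
by exists (k, t); rewrite mem_enum.
Qed.

Lemma words_uniq n : uniq (words n).
Proof.
elim: n => //= n IHn; apply: allpairs_uniq => //; first exact: enum_uniq.
by move=> [k s] [l t] _ _ /= [-> ->].
Qed.

Lemma big_words_delta n t (f : seq 'I_r -> C) : size t = n ->
  \sum_(s <- words n) (s == t)%:R * f s = f t.
Proof.
move=> nt; rewrite (bigD1_seq t) ?words_uniq ?mem_words ?nt ?eqxx //= mul1r.
by rewrite big1 ?addr0 // => s /negPf->; rewrite mul0r.
Qed.

End Words.

Section Magnus.
Variables (r : nat) (C : fieldType) (Q : 'M[C]_r).
Implicit Types (s t : seq 'I_r).
Local Notation F := (free_group 'I_r).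
Local Notation gen := (@free_gen 'I_r).
Local Notation D := (dimension_subgroup C).

(** For Q = 1 this is the coefficient of the word t in the Magnus expansion
    sending the generator x_i to 1 + X_i.  A general matrix Q amounts to a linear
    change of the variables X_i, which makes it possible to work in a basis where
    a given endomorphism acts by a triangular matrix. *)
Fixpoint magnus t : F -> C :=
  if t is k :: t' then integral (fun j g => Q j k * magnus t' g) else fun=> 1.
Arguments magnus t g : simpl never.

Lemma magnus_gen k t j g :
  magnus (k :: t) (gen j * g)%g = magnus (k :: t) g + Q j k * magnus t g.
Proof. exact: integral_gen. Qed.

Lemma magnus_genV k t j g : magnus (k :: t) ((gen j)^-1 * g)%g =
  magnus (k :: t) g - Q j k * magnus t ((gen j)^-1 * g)%g.
Proof.
have := magnus_gen k t j ((gen j)^-1 * g)%g.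
by rewrite mulVKg => ->; rewrite addrK.
Qed.

Lemma magnus1 t : magnus t 1%g = (t == [::])%:R.
Proof. by case: t. Qed.

Lemma degree_lt_gen n (f : F -> C) :
  (forall k, degree_lt n (ldiff (gen k) f)) -> degree_lt n.+1 f.
Proof.
move=> Pf; elim/free_group_ind => [|k g IHg|k g IHg].
- by apply: degree_lt_ext (degree_lt0 _ _ n) => x; rewrite /ldiff mul1g subrr.
- apply: degree_lt_ext (degree_ltD (degree_lt_ltrans g (Pf k)) IHg) => x.
  by rewrite /ldiff -!mulgA; ring.
- apply: degree_lt_ext
    (degree_ltB IHg (degree_lt_ltrans ((gen k)^-1 * g)%g (Pf k))) => x.
  by rewrite /ldiff -!mulgA mulVKg; ring.
Qed.

Lemma magnus_degree t : degree_lt (size t).+1 (magnus t).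
Proof.
elim: t => [|k t IHt]; first exact: degree_lt_const.
apply: degree_lt_gen => j; apply: degree_lt_ext (degree_ltZ (Q j k) IHt) => x.
by rewrite /ldiff magnus_gen addrC addKr.
Qed.

Lemma magnusD k : {morph magnus [:: k] : x y / (x * y)%g >-> x + y}.
Proof.
move=> x y; have := dim_additive (ltn0Sn 0) (dim1 x) (dim1 y)
  (magnus_degree [:: k]).
by rewrite magnus1 !subr0.
Qed.

Lemma magnusV k x : magnus [:: k] x^-1%g = - magnus [:: k] x.
Proof. by apply/eqP; rewrite -addr_eq0 -magnusD mulVg magnus1. Qed.

Lemma magnus_letter k j : magnus [:: k] (gen j) = Q j k.
Proof. by rewrite -[gen j]mulg1 magnus_gen magnus1 add0r mulr1. Qed.

(** To leading order, the difference by g strips off the first letter k and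
    multiplies by the value at g of the homomorphism attached to k. *)
Lemma magnus_ldiff k t g : degree_lt (size t)
  (fun x => ldiff g (magnus (k :: t)) x - magnus [:: k] g * magnus t x).
Proof.
elim/free_group_ind: g => [|j g IHg|j g IHg].
- apply: degree_lt_ext (degree_lt0 _ _ _) => x.
  by rewrite /ldiff mul1g magnus1 mul0r !subrr.
- apply: degree_lt_ext (degree_ltZD (Q j k) (magnus_degree t g) IHg) => x.
  rewrite magnusD magnus_letter /ldiff -!mulgA magnus_gen; ring.
- apply: degree_lt_ext
    (degree_ltZD (- Q j k) (magnus_degree t ((gen j)^-1 * g)%g) IHg) => x.
  by rewrite magnusD magnusV magnus_letter /ldiff -!mulgA magnus_genV; ring.
Qed.

Lemma magnus_rdiff k t g : degree_lt (size t)
  (fun x => rdiff g (magnus (rcons t k)) x - magnus [:: k] g * magnus t x).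
Proof.
elim: t => [|l t IHt].
  by move=> x; rewrite /rdiff [rcons _ _]/= magnusD mulr1; ring.
apply: degree_lt_gen => j; apply: degree_lt_ext (degree_ltZ (Q j l) IHt) => x.
rewrite /ldiff /rdiff rcons_cons -!mulgA !magnus_gen; ring.
Qed.

(** The matrix of phi on the linear coefficients determines its action on all
    coefficients of words of length n, up to functions of lower degree, as its
    n-th tensor power. *)
Section Triangular.
Variables (phi : F -> F) (L : 'M[C]_r).
Hypothesis phiM : {morph phi : x y / (x * y)%g}.
Hypothesis phiL :
  forall k g, magnus [:: k] (phi g) = \sum_l L k l * magnus [:: l] g.

Fixpoint tensor_power s t : C :=
  match s, t with
  | [::], [::] => 1
  | k :: s', l :: t' => L k l * tensor_power s' t'
  | _, _ => 0
  end.

Lemma magnus_comp t : degree_lt (size t)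
  (fun x => magnus t (phi x)
            - \sum_(s <- words r (size t)) tensor_power t s * magnus s x).
Proof.
elim: t => [|k t IHt] /=; first by move=> x; rewrite /= big_seq1 /= mulr1 subrr.
apply: degree_lt_gen => j.
pose tail x := \sum_(s <- words r (size t)) tensor_power t s * magnus s x.
have gen_sum x : \sum_(s <- words r (size t).+1)
      tensor_power (k :: t) s * magnus s (gen j * x)%g
    = \sum_(s <- words r (size t).+1) tensor_power (k :: t) s * magnus s x
      + magnus [:: k] (phi (gen j)) * tail x.
  rewrite !big_words_cons phiL mulr_suml -big_split; apply: eq_bigr => l _ /=.
  rewrite magnus_letter mulr_sumr -big_split; apply: eq_bigr => s _ /=.
  by rewrite magnus_gen; ring.
apply: degree_lt_ext (degree_ltZD (magnus [:: k] (phi (gen j))) IHt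
  (degree_lt_comp phiM (magnus_ldiff k t (phi (gen j))))) => x.
by rewrite /ldiff /= -!/(words r (size t).+1) gen_sum phiM /tail; ring.
Qed.

End Triangular.

(** On the n-th dimension subgroup, n > 0, the coefficients of words of length n
    are homomorphisms, and these are their linear combinations. *)
Definition leading n (m : seq 'I_r -> C) w :=
  \sum_(t <- words r n) m t * magnus t w.

Lemma leadingZD n a m1 m2 w :
  leading n (fun t => a * m1 t + m2 t) w = a * leading n m1 w + leading n m2 w.
Proof.
rewrite /leading mulr_sumr -big_split; apply: eq_bigr => t _ /=.
by rewrite mulrDl mulrA.
Qed.

Lemma leadingZ n a m w : leading n (fun t => a * m t) w = a * leading n m w.
Proof. by rewrite /leading mulr_sumr; apply: eq_bigr => t _; rewrite mulrA. Qed.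

Lemma leading_delta n t w : size t = n ->
  leading n (fun s => (s == t)%:R) w = magnus t w.
Proof. exact: big_words_delta. Qed.

Lemma leading_degree n m : degree_lt n.+1 (leading n m).
Proof.
apply: degree_lt_sum => t; rewrite mem_words => /eqP <-.
exact/degree_ltZ/magnus_degree.
Qed.

Lemma leading1 n m : (0 < n)%N -> leading n m 1%g = 0.
Proof.
move=> n0; rewrite /leading big_seq big1 // => t; rewrite mem_words magnus1.
by case: t => [/eqP|k t _] /=; [lia | rewrite mulr0].
Qed.

Lemma leadingD n m x y : (0 < n)%N -> D n x -> D n y ->
  leading n m (x * y)%g = leading n m x + leading n m y.
Proof.
move=> n0 Dx Dy; have := dim_additive n0 Dx Dy (leading_degree n m).
by rewrite leading1 // !subr0.
Qed.

Lemma polarization_rcons k t w g : (0 < size t)%N -> D (size t) w ->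
  polarization (magnus (rcons t k)) w g = magnus [:: k] g * magnus t w.
Proof.
move=> t0 Dw; have := Dw _ (magnus_rdiff k t g).
rewrite polarizationEr magnus1; case: t t0 {Dw} => //= l t _ E.
by apply: subr0_eq; rewrite -(subrr (rdiff g (magnus (l :: rcons t k)) 1%g));
  move: E; rewrite mulr0 subr0 => <-; ring.
Qed.

Lemma polarization_cons k t w g : (0 < size t)%N -> D (size t) w ->
  polarization (magnus (k :: t)) g w = magnus [:: k] g * magnus t w.
Proof.
move=> t0 Dw; have := Dw _ (magnus_ldiff k t g).
rewrite polarizationEl magnus1; case: t t0 {Dw} => //= l t _ E.
by apply: subr0_eq; rewrite -(subrr (ldiff g (magnus [:: k, l & t]) 1%g));
  move: E; rewrite mulr0 subr0 => <-; ring.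
Qed.

(** The leading part of a commutator is the Lie bracket of the leading parts;
    dually, a combination m of words of length n+1 is turned into the
    combinations, one for each letter k, that pair with the bracket by k. *)
Lemma leading_commg n m w g : (0 < n)%N -> D n w ->
  leading n.+1 m [~ w, g]%g =
    \sum_k magnus [:: k] g
           * leading n (fun t => m (rcons t k) - m (k :: t)) w.
Proof.
move=> n0 Dw.
have Pm : degree_lt (n + 1).+1 (leading n.+1 m).
  by rewrite addn1; apply: leading_degree.
have := commutator_leading Dw (dim1 g) Pm; rewrite leading1 // subr0 => ->.
have polE x y : polarization (leading n.+1 m) x y
    = \sum_(t <- words r n.+1) m t * polarization (magnus t) x y.
  rewrite /polarization /leading -!sumrB -big_split; apply: eq_bigr => t _ /=.
  ring.
rewrite !polE big_words_rcons big_words_cons -sumrB; apply: eq_bigr => k _.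
rewrite /leading mulr_sumr -sumrB !big_seq; apply: eq_bigr => t.
rewrite mem_words => /eqP nt; move: n0 Dw; rewrite -nt => n0 Dw.
by rewrite polarization_rcons // polarization_cons //; ring.
Qed.

(** The value of the linear form m on the left-normed Lie monomial whose letters
    are the entries of s, the head of s being the outermost one: for s = k :: s'
    the monomial is [b, k] with b the monomial of s'. *)
Fixpoint bracket s (m : seq 'I_r -> C) : C :=
  match s with
  | [::] => 0
  | [:: k] => m [:: k]
  | k :: s' => bracket s' (fun t => m (rcons t k) - m (k :: t))
  end.

Lemma bracketB s m1 m2 :
  bracket s (fun t => m1 t - m2 t) = bracket s m1 - bracket s m2.
Proof.
elim: s m1 m2 => [|k [|l s] IHs] m1 m2 //; first by rewrite subrr.
rewrite -[RHS](IHs (fun t => m1 (rcons t k) - m1 (k :: t))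
                   (fun t => m2 (rcons t k) - m2 (k :: t))).
by apply: (congr1 (bracket (l :: s))); apply/funext => t; ring.
Qed.

Lemma bracket_perm s m : (forall t, perm_eq t s -> m t = 0) -> bracket s m = 0.
Proof.
elim: s m => [|k [|l s] IHs] m m0 //; first exact: m0.
apply: IHs => t ts; rewrite !m0 ?subrr ?perm_cons //.
by rewrite perm_rcons perm_cons.
Qed.

Section Basis.
Hypothesis Qu : Q \in unitmx.

(** The left differences of f at the generators have smaller degree, hence are
    combinations b j of coefficients up to lower degree; inverting Q makes
    these combinations the differences of a single combination of coefficients. *)
Lemma degree_lt_span n (f : F -> C) : degree_lt n.+1 f ->
  exists b, degree_lt n (fun x => f x - \sum_(t <- words r n) b t * magnus t x).
Proof.
elim: n f => [|n IHn] f Pf.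
  exists (fun=> f 1%g) => x; rewrite /= big_seq1 mulr1; apply/eqP.
  by rewrite subr_eq0 (dim1 x Pf).
have /choice[b Pb] j := IHn _ (Pf (gen j)).
exists (fun t => if t is k :: t' then \sum_j invmx Q k j * b j t' else 0).
apply: degree_lt_gen => j; apply: degree_lt_ext (Pb j) => x.
rewrite {2}/ldiff !big_words_cons /=.
have -> : forall u v y z : C, u - v - (y - z) = (u - y) - (v - z).
  by move=> *; ring.
congr (_ - _); rewrite -sumrB.
under [in RHS]eq_bigr do rewrite -sumrB.
rewrite exchange_big; apply: eq_bigr => t _.
under eq_bigr do rewrite magnus_gen -mulrBr addrC addKr mulrA.
rewrite -mulr_suml; congr (_ * _).
under eq_bigr do rewrite mulr_suml.
rewrite exchange_big /=.
have QV l : \sum_k invmx Q k l * Q j k = (j == l)%:R.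
  have /matrixP/(_ j l) := mulmxV Qu; rewrite !mxE => <-.
  by apply: eq_bigr => k _; rewrite mulrC.
transitivity (\sum_l (j == l)%:R * b l t).
  rewrite (bigD1 j) //= eqxx mul1r big1 ?addr0 // => l /negPf nl.
  by rewrite eq_sym nl mul0r.
apply: eq_bigr => l _; rewrite -QV mulr_suml.
by apply: eq_bigr => k _; rewrite mulrAC.
Qed.

(** The successive dimension subgroups of a free group are thus cut out by the
    coefficients: this is the filtration by order of the Magnus expansion. *)
Lemma dim_magnus n w : (0 < n)%N -> D n w ->
  (forall t, size t = n -> magnus t w = 0) -> D n.+1 w.
Proof.
move=> n0 Dw cw f /degree_lt_span[b Pb].
have Eb x : (forall t, size t = n -> magnus t x = 0) ->
    \sum_(t <- words r n) b t * magnus t x = 0.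
  move=> cx; rewrite big_seq big1 // => t; rewrite mem_words => /eqP /cx ->.
  by rewrite mulr0.
have := Dw _ Pb; rewrite /= !Eb ?subr0 // => t nt.
by rewrite magnus1; case: t nt n0 => //= <-.
Qed.

(** The values of the linear coefficients at the generators form the invertible
    matrix Q. *)
Lemma eq0_of_letters (v : 'I_r -> C) :
  (forall j, \sum_k Q j k * v k = 0) -> forall k, v k = 0.
Proof.
move=> Qv k; pose V : 'cV[C]_r := \col_i v i.
have QV : Q *m V = 0.
  apply/colP => j; rewrite !mxE -[RHS](Qv j); apply: eq_bigr => i _.
  by rewrite mxE.
have /colP/(_ k) : V = 0 by rewrite -(mulKmx Qu V) QV mulmx0.
by rewrite !mxE.
Qed.

(** The Lie monomial in the variables of the basis given by Q is a linear
    combination of leading parts of iterated commutators of generators, so a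
    linear form vanishing on all leading parts vanishes on it.  Arguing with
    relations instead of combinations lets the induction run one letter at a
    time. *)
Lemma bracket_relation s m : s != [::] ->
  (forall w, D (size s) w -> leading (size s) m w = 0) -> bracket s m = 0.
Proof.
elim: s m => [|k [|l s] IHs] m // _ m0.
  apply: (eq0_of_letters (v := fun k => m [:: k])) => j.
  rewrite -[RHS](m0 (gen j) (dim1 _)).
  rewrite /leading big_words_cons; apply: eq_bigr => l _.
  by rewrite /= big_seq1 magnus_letter mulrC.
apply: IHs => // w Dw.
pose v k' := leading (size s).+1 (fun t => m (rcons t k') - m (k' :: t)) w.
apply: (eq0_of_letters (v := v)) => j.
rewrite -[RHS](m0 [~ w, gen j]%g).
  rewrite [size (k :: _)]/= leading_commg //; apply: eq_bigr => k' _.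
  by rewrite magnus_letter.
rewrite -[size (k :: _)]addn1; apply: dim_commg => //; exact: dim1.
Qed.

End Basis.

(** * Leading parts fixed by a triangular endomorphism *)

Section Invariants.
Variables (phi : F -> F) (L : 'M[C]_r).
Hypothesis phiM : {morph phi : x y / (x * y)%g}.
Hypothesis phiL :
  forall k g, magnus [:: k] (phi g) = \sum_l L k l * magnus [:: l] g.
Hypothesis Ltrig : is_trig_mx L.

Definition weight t := (\sum_(k <- t) k)%N.

Lemma tensor_power_diag t : tensor_power L t t = \prod_(k <- t) L k k.
Proof. by elim: t => [|k t IHt]; rewrite ?big_nil //= big_cons IHt. Qed.

(** The tensor power of a triangular matrix is triangular for the order by the
    sum of the letters.  Distinct words of equal weight do not interact. *)
Lemma tensor_power_trig t s : s != t -> tensor_power L t s != 0 ->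
  (weight s < weight t)%N.
Proof.
have Ltrig' k l : L k l != 0 -> (l <= k)%N.
  by apply: contraNT; rewrite -ltnNge => kl; rewrite (is_trig_mxP Ltrig).
rewrite /weight; elim: t s => [|k t IHt] [|l s] /=; rewrite ?eqxx //.
rewrite eqseq_cons mulf_eq0 negb_or !big_cons => nst /andP[/Ltrig' lk Lts].
have [st|nst'] := eqVneq s t; last by have := IHt _ nst' Lts; lia.
move: nst; rewrite st eqxx andbT => /eqP nlk.
have : nat_of_ord l <> k by move/val_inj.
by move=> /eqP; lia.
Qed.

Variable n : nat.
Hypothesis n_gt0 : (0 < n)%N.

Lemma magnus_phi t w : size t = n -> D n w ->
  magnus t (phi w) = leading n (tensor_power L t) w.
Proof.
move=> nt Dw; have := magnus_comp phiM phiL t; rewrite nt => /Dw.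
rewrite -!/(leading _ _ _) leading1 // (morph_one phiM) magnus1.
case: t nt n_gt0 => [<- //|k t nt _] /= /eqP.
by rewrite subr0 subr_eq0 => /eqP.
Qed.

Definition invariant m :=
  forall w, D n w -> leading n m (phi w) = leading n m w.

Definition supported v (m : seq 'I_r -> C) :=
  forall t, m t != 0 -> (weight t < v)%N.

(** The functions in the image of phi^* - 1, where phi^* is composition with phi,
    acting on the combinations of words of weight less than v restricted to the
    n-th dimension subgroup. *)
Definition coboundary v (f : F -> C) := exists m, supported v m /\
  forall w, D n w -> f w = leading n m (phi w) - leading n m w.

Lemma supportedZD v a m1 m2 :
  supported v m1 -> supported v m2 -> supported v (fun t => a * m1 t + m2 t).
Proof.
move=> S1 S2 t; have [->|/S1 //] := eqVneq (m1 t) 0.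
by rewrite mulr0 add0r => /S2.
Qed.

Lemma supportedW u v m : (u <= v)%N -> supported u m -> supported v m.
Proof. by move=> uv Su t /Su; lia. Qed.

Lemma coboundaryW u v f : (u <= v)%N -> coboundary u f -> coboundary v f.
Proof.
by move=> uv [m [Sm fE]]; exists m; split=> //; apply: supportedW Sm.
Qed.

Lemma coboundary_leading v m :
  (forall t, size t = n -> (weight t < v)%N -> coboundary v (magnus t)) ->
  supported v m -> coboundary v (leading n m).
Proof.
move=> cob Sm; rewrite /leading.
have : {in words r n, forall t, size t = n}.
  by move=> t; rewrite mem_words => /eqP.
elim: (words r n) => [|t ws IHws] sz.
  exists (fun=> 0); split=> [t|w _]; first by rewrite eqxx.
  by rewrite big_nil /leading !big1 ?subrr // => t _; rewrite mul0r.
have [|m2 [S2 E2]] := IHws.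
  by move=> s sws; apply: sz; rewrite inE sws orbT.
have [mt0|/Sm mt] := eqVneq (m t) 0.
  by exists m2; split=> // w Dw; rewrite big_cons mt0 mul0r add0r E2.
have [m1 [S1 E1]] := cob t (sz _ (mem_head _ _)) mt.
exists (fun s => m t * m1 s + m2 s); split; first exact: supportedZD.
by move=> w Dw; rewrite big_cons E1 // E2 // !leadingZD; ring.
Qed.

(** Under this hypothesis phi^* - 1 is injective on the combinations of words of
    length n, restricted to the n-th dimension subgroup.  Triangularity then
    yields its surjectivity weight by weight, without any dimension count. *)
Hypothesis no_invariant :
  forall m, invariant m -> forall w, D n w -> leading n m w = 0.

Lemma magnus_primitive t : size t = n ->
  (forall s, size s = n -> (weight s < weight t)%N ->
     coboundary (weight t) (magnus s)) ->
  exists m, supported (weight t) m /\ forall w, D n w ->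
    magnus t (phi w) - tensor_power L t t * magnus t w =
    leading n m (phi w) - leading n m w.
Proof.
move=> nt cob.
pose low s := tensor_power L t s - tensor_power L t t * (s == t)%:R.
have Slow : supported (weight t) low.
  move=> s; rewrite /low; have [->|st] := eqVneq s t.
    by rewrite mulr1 subrr eqxx.
  by rewrite mulr0 subr0; apply: tensor_power_trig.
have [m [Sm E]] := coboundary_leading cob Slow.
exists m; split=> // w Dw; rewrite -E // magnus_phi //.
rewrite -(leading_delta w nt) /low /leading mulr_sumr -sumrB.
by apply: eq_bigr => s _; ring.
Qed.

(** When the diagonal entry at t is 1, (phi^* - 1) maps the coefficient of t to
    a combination of words of smaller weight, hence to (phi^* - 1) of such a
    combination m; the coefficient of t minus m is fixed, so it is 0. *)
Lemma magnus_dependent t : size t = n -> tensor_power L t t = 1 ->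
  (forall s, size s = n -> (weight s < weight t)%N ->
     coboundary (weight t) (magnus s)) ->
  exists m, supported (weight t) m /\
    forall w, D n w -> magnus t w = leading n m w.
Proof.
move=> nt L1 /(magnus_primitive nt)[m [Sm E]]; exists m; split=> //.
pose m' s := -1 * m s + (s == t)%:R.
have m'E w : leading n m' w = magnus t w - leading n m w.
  by rewrite leadingZD leading_delta // mulN1r addrC.
have /no_invariant m'0 : invariant m'.
  move=> w Dw; apply: subr0_eq; have := E w Dw; rewrite L1 mul1r => {}E.
  by rewrite !m'E -(subrr (magnus t (phi w) - magnus t w)) {2}E; ring.
by move=> w /m'0; rewrite m'E => /eqP; rewrite subr_eq0 => /eqP.
Qed.

(** If the diagonal entry at t differs from 1, the coefficient of t is obtained by
    dividing by its difference from 1; otherwise the coefficient is already a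
    combination of words of smaller weight. *)
Lemma magnus_coboundary v t : size t = n -> (weight t < v)%N ->
  coboundary v (magnus t).
Proof.
elim: v t => // v IHv t nt; rewrite ltnS leq_eqVlt.
case/orP => [/eqP tv|tv]; last by apply: coboundaryW (IHv _ nt tv).
have cob s : size s = n -> (weight s < weight t)%N ->
    coboundary (weight t) (magnus s) by rewrite tv; apply: IHv.
have [L1|L1] := eqVneq (tensor_power L t t) 1.
  have [m [Sm E]] := magnus_dependent nt L1 cob.
  have [m' [Sm' E']] := coboundary_leading cob Sm.
  exists m'; split=> [|w Dw]; first by apply: supportedW Sm'; rewrite tv.
  by rewrite E // E'.
have [m [Sm E]] := magnus_primitive nt cob.
pose a := (tensor_power L t t - 1)^-1.
have aL : a * (tensor_power L t t - 1) = 1 by rewrite mulVf // subr_eq0.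
exists (fun s => a * (-1 * m s + (s == t)%:R)); split=> [s|w Dw].
  have [->|st] := eqVneq s t; first by rewrite tv.
  rewrite addr0 !mulf_eq0 !negb_or => /andP[_ /andP[_ /Sm]].
  by rewrite tv; lia.
rewrite !leadingZ !leadingZD !leading_delta // !mulN1r.
rewrite -[LHS]mul1r -aL -mulrA -mulrBr.
have {}E := E w Dw; congr (a * _).
apply: subr0_eq; rewrite -(subrr (leading n m (phi w) - leading n m w)) -{2}E.
ring.
Qed.

End Invariants.
End Magnus.
(** * A Lie monomial with every letter twice *)

Section DoubleWord.
Variables (r : nat) (C : numFieldType).
Implicit Types (s t ks : seq 'I_r).

(** A bracketing letter k that differs from the first letter i of the target word
    can only have been placed at the right end. *)
Lemma bracket_append ks i t s : i \notin ks -> s != [::] ->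
  bracket (rev ks ++ s) (fun u => (u == i :: t ++ ks)%:R) =
  bracket s (fun u => (u == i :: t)%:R) :> C.
Proof.
elim/last_ind: ks => [|ks k IHks]; first by rewrite cats0.
rewrite mem_rcons inE negb_or => /andP[ik iks] s0; rewrite -IHks //.
rewrite rev_rcons -rcons_cat -rcons_cons cat_cons.
have [l [s' ->]] : exists l s', rev ks ++ s = l :: s'.
  case: (rev ks) => [|l u]; last by exists l, (u ++ s).
  by case: (s) s0 => // l u _; exists l, u.
apply: (congr1 (bracket (l :: s'))); apply/funext => u.
by rewrite eqseq_rcons eqxx andbT [k :: u == _]eqseq_cons [k == i]eq_sym
           (negPf ik) subr0.
Qed.

(** In the free associative ring, xyxy has coefficient 2 in [[[x, y], y], x]. *)
Lemma bracket_xyyx (i j : 'I_r) : i != j ->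
  bracket [:: i; j; j; i] (fun u => (u == [:: i; j; i; j])%:R) = 2%:R :> C.
Proof.
move=> ij; rewrite /= !eqseq_cons !eqxx (negPf ij) [j == i]eq_sym (negPf ij) /=.
by rewrite !(subr0, sub0r, opprK).
Qed.

(** Start from the bracket [[[x, y], y], x] and bracket it twice with each of
    the remaining letters: the coefficient 2 of xyxy survives by
    bracket_append. *)
Lemma exists_double_word : (2 <= r)%N -> exists s t,
  [/\ perm_eq t s, perm_eq t (enum 'I_r ++ enum 'I_r) &
      bracket s (fun u => (u == t)%:R) != 0 :> C].
Proof.
move=> r2; pose i := Ordinal (ltnW r2); pose j := Ordinal r2.
pose ks := [seq k <- enum 'I_r | k \notin [:: i; j]].
have enumE : perm_eq (enum 'I_r) [:: i, j & ks].
  apply: uniq_perm => [||k]; first exact: enum_uniq.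
    by rewrite /= !inE !mem_filter !inE !eqxx !orbT filter_uniq ?enum_uniq.
  by rewrite mem_enum !inE mem_filter !inE mem_enum andbT orbA orbN.
exists (rev (ks ++ ks) ++ [:: i; j; j; i]), ([:: i; j; i; j] ++ ks ++ ks).
split.
- apply/permP => p; rewrite !count_cat count_rev !count_cat /=; lia.
- apply/permP => p; move/permP/(_ p): enumE; rewrite !count_cat /=; lia.
- rewrite -[[:: i; j; i; j] ++ _]/(i :: [:: j; i; j] ++ (ks ++ ks)).
  rewrite bracket_append // ?bracket_xyyx ?pnatr_eq0 //.
  by rewrite mem_cat mem_filter !inE eqxx.
Qed.

End DoubleWord.

(** * Twisted conjugacy in a free group *)

Section TwistedFree.
Variables (r : nat) (C : numFieldType) (Q L : 'M[C]_r).
Local Notation F := (free_group 'I_r).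
Local Notation gen := (@free_gen 'I_r).
Local Notation D := (dimension_subgroup C).
Variable phi : F -> F.
Hypothesis r_ge2 : (2 <= r)%N.
Hypothesis Qu : Q \in unitmx.
Hypothesis phiM : {morph phi : x y / (x * y)%g}.
Hypothesis phiL :
  forall k g, magnus Q [:: k] (phi g) = \sum_l L k l * magnus Q [:: l] g.
Hypothesis Ltrig : is_trig_mx L.
Hypothesis Ldet : \det L ^+ 2 = 1.

Definition nontrivial_invariant n := exists m, invariant Q phi n m /\
  exists2 w, D n w & leading Q n m w != 0.

Lemma no_nontrivial_invariant n : ~ nontrivial_invariant n ->
  forall m, invariant Q phi n m -> forall w, D n w -> leading Q n m w = 0.
Proof.
move=> ninv m minv w Dw; apply/eqP/negP => /negP mw0.
by case: ninv; exists m; split=> //; exists w.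
Qed.

(** For the word t of exists_double_word the diagonal entry is the square of
    det L, that is 1.  Without invariants, the coefficient of t would agree on
    the 2r-th dimension subgroup with a combination of words of smaller weight,
    none of which is a rearrangement of t.  This relation contradicts the
    nonvanishing of t on the Lie monomial. *)
Lemma nontrivial_invariant_double : nontrivial_invariant (2 * r).
Proof.
apply: contrapT => ninv; have n0 : (0 < 2 * r)%N by lia.
have [s [t [ts tE st]]] := exists_double_word C r_ge2.
have nt : size t = (2 * r)%N.
  by rewrite (perm_size tE) size_cat size_enum_ord addnn mul2n.
have L1 : tensor_power L t t = 1.
  rewrite tensor_power_diag (perm_big _ tE) big_cat /= big_enum /= -expr2.
  by rewrite -det_trig.
have noinv := no_nontrivial_invariant ninv.
have cob u : size u = (2 * r)%N -> (weight u < weight t)%N ->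
    coboundary Q phi (2 * r) (weight t) (magnus Q u).
  exact: magnus_coboundary.
have [m [Sm E]] := magnus_dependent phiM phiL Ltrig n0 noinv nt L1 cob.
have szs : size s = (2 * r)%N by rewrite -(perm_size ts).
have s0 : s != [::] by rewrite -size_eq0 szs -lt0n.
have : bracket s (fun u => (u == t)%:R - m u) = 0.
  apply: (bracket_relation Qu) => // w; rewrite szs => Dw.
  rewrite -[RHS](subrr (leading Q (2 * r) m w)) -{1}(E w Dw).
  by rewrite -(leading_delta Q w nt) /leading -sumrB;
     apply: eq_bigr => u _; rewrite mulrBl.
rewrite bracketB [X in _ - X]bracket_perm ?subr0; first exact/eqP.
move=> u us; apply/eqP/negP => /negP /Sm.
have ut : perm_eq u t by rewrite (perm_trans us) // perm_sym.
by rewrite /weight (perm_big _ ut) ltnn.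
Qed.

(** Climb the filtration: if x lies in the m-th dimension subgroup with m < n,
    each coefficient c of length m is c' \o phi - c' for some combination c',
    so c x is the value of c' at (phi x) x^-1, which is 0. *)
Lemma twisted_fixed_dim n :
  (forall m, (0 < m < n)%N -> ~ nontrivial_invariant m) ->
  forall x, D n (phi x * x^-1)%g -> D n x.
Proof.
move=> ninv x Dphi; case: n ninv Dphi => [|n] ninv Dphi.
  exact: dim_leq (dim1 x).
suff H m : (m <= n)%N -> D m.+1 x by exact: H.
elim: m => [|m IHm] mn; first exact: dim1.
have Dx := IHm (ltnW mn); apply: (dim_magnus Qu) => // t nt.
have /no_nontrivial_invariant noinv : ~ nontrivial_invariant m.+1.
  exact: ninv.
have [c [_ E]] := magnus_coboundary phiM phiL Ltrig (ltn0Sn m) noinv nt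
  (ltnSn (weight t)).
have Dp : D m.+2 (phi x * x^-1)%g by apply: dim_leq Dphi.
rewrite E // -[phi x](mulgVK x) leadingD //; last exact: dim_leq Dp.
by rewrite addrK (Dp _ (leading_degree Q m.+1 c)) leading1.
Qed.

(** Take n least with a nontrivial invariant homomorphism h, and w with h w != 0.
    A twisted conjugacy between w ^+ k and w ^+ l forces the conjugating element
    x into the n-th dimension subgroup, where h (phi x) = h x leaves only
    k * h w = l * h w.  The factor d makes the conclusion insensitive to passing
    to a quotient. *)
Lemma twisted_separation : exists z : nat -> F, forall k l x d,
  D (2 * r).+1 d -> (phi x * (z k * d) = z l * x)%g -> k = l.
Proof.
pose P n := (0 < n)%N && `[< nontrivial_invariant n >].
have exP : exists n, P n.
  exists (2 * r)%N; apply/andP; split; first by lia.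
  by apply/asboolP; apply: nontrivial_invariant_double.
case: (ex_minnP exP) => n /andP[n0 /asboolP [m [minv [w Dw mw]]]] nmin.
have n2r : (n <= 2 * r)%N.
  apply: nmin; apply/andP; split; first by lia.
  by apply/asboolP; apply: nontrivial_invariant_double.
have ninv j : (0 < j < n)%N -> ~ nontrivial_invariant j.
  move=> /andP[j0 jn] jinv; have : (n <= j)%N.
    by apply: nmin; rewrite /P j0; apply/asboolP.
  by rewrite leqNgt jn.
have Dwk k : D n (w ^+ k)%g.
  elim: k => [|k IHk]; first exact: dim_one.
  by rewrite expgS; apply: dimM.
have mwk k : leading Q n m (w ^+ k)%g = leading Q n m w *+ k.
  elim: k => [|k IHk]; first by rewrite leading1.
  by rewrite expgS leadingD // IHk mulrS.
exists (fun k => w ^+ k)%g => k l x d Dd E.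
have Dnd : D n d by apply: dim_leq Dd; lia.
have md : leading Q n m d = 0.
  by rewrite (dim_leq _ Dd (leading_degree Q n m)) ?leading1.
have Dx : D n x.
  apply: twisted_fixed_dim => //.
  have -> : (phi x * x^-1 = w ^+ l * (x * (w ^+ k * d)^-1 * x^-1))%g.
    by rewrite !mulgA -E mulgK.
  by apply/dimM/dim_conj/dimV/dimM.
have := congr1 (leading Q n m) E.
rewrite !leadingD ?minv ?md ?addr0 ?mwk //; try exact: dimM; last first.
  exact: dim_morph.
by rewrite addrC => /addIr/(mulrIn mw).
Qed.

End TwistedFree.
(** * The action on the abelianization *)

Section Abelianization.
Variable r : nat.
Local Notation F := (free_group 'I_r).
Local Notation gen := (@free_gen 'I_r).
Local Notation D := (dimension_subgroup algC).

Definition exponent (j : 'I_r) : F -> algC := magnus 1%:M [:: j].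

Lemma additive_gens (h : F -> algC) : {morph h : x y / (x * y)%g >-> x + y} ->
  forall g, h g = \sum_i exponent i g * h (gen i).
Proof.
move=> hM; have h1 : h 1%g = 0.
  by apply: (addrI (h 1%g)); rewrite -hM mulg1 addr0.
have hV x : h x^-1%g = - h x.
  by apply/eqP; rewrite -addr_eq0 -hM mulVg h1.
have expE k : \sum_i exponent i (gen k) * h (gen i) = h (gen k).
  rewrite (bigD1 k) //= big1 => [|i /negPf ik].
    by rewrite /exponent magnus_letter mxE eqxx mul1r addr0.
  by rewrite /exponent magnus_letter mxE eq_sym ik mul0r.
elim/free_group_ind => [|k g IHg|k g IHg].
- by rewrite h1 big1 // => i _; rewrite /exponent magnus1 mul0r.
- rewrite hM IHg -(expE k) -big_split; apply: eq_bigr => i _ /=.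
  by rewrite /exponent magnusD [RHS]mulrDl.
- rewrite hM hV IHg -(expE k) -sumrN -big_split; apply: eq_bigr => i _ /=.
  by rewrite /exponent magnusD magnusV [RHS]mulrDl mulNr.
Qed.

Lemma exponent_int j g : exponent j g \is a Num.int.
Proof.
elim/free_group_ind: g => [|k g IHg|k g IHg].
- by rewrite /exponent magnus1 rpred_nat.
- rewrite /exponent magnusD magnus_letter mxE rpredD // ?rpred_nat //.
- rewrite /exponent magnusD magnusV magnus_letter mxE rpredD // ?rpredN.
  exact: rpred_nat.
Qed.

Definition abelianized (phi : F -> F) : 'M[algC]_r :=
  \matrix_(i, j) exponent j (phi (gen i)).

Lemma exponent_morph (phi : F -> F) j g : {morph phi : x y / (x * y)%g} ->
  exponent j (phi g) = \sum_i exponent i g * abelianized phi i j.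
Proof.
move=> phiM.
have /additive_gens/(_ g) /= ->
    : {morph exponent j \o phi : x y / (x * y)%g >-> x + y}.
  by move=> x y; rewrite /= phiM /exponent magnusD.
by apply: eq_bigr => i _; rewrite mxE.
Qed.

(** The matrices of phi and psi are inverse to each other and have integer
    entries, so their determinants are 1 or -1. *)
Lemma abelianized_det (phi psi : F -> F) :
  {morph phi : x y / (x * y)%g} -> {morph psi : x y / (x * y)%g} ->
  (forall g, D 2 (g^-1 * psi (phi g))%g) -> \det (abelianized phi) ^+ 2 = 1.
Proof.
move=> phiM psiM psiK.
have AB : abelianized phi *m abelianized psi = 1%:M.
  apply/matrixP => i j; rewrite !mxE.
  have := exponent_morph j (phi (gen i)) psiM.
  have -> : exponent j (psi (phi (gen i))) = exponent j (gen i).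
    have := psiK (gen i) _ (magnus_degree 1%:M [:: j]).
    rewrite /exponent magnusD magnusV magnus1 addrC => /eqP.
    by rewrite subr_eq0 => /eqP.
  rewrite /exponent magnus_letter mxE => ->.
  by apply: eq_bigr => k _; rewrite !mxE.
have intdet th : \det (abelianized th) \is a Num.int.
  apply: rpred_sum => s _; apply: rpredM; first by rewrite rpred_sign.
  by apply: rpred_prod => i _; rewrite mxE exponent_int.
have /intrP[a aE] := intdet phi; have /intrP[b bE] := intdet psi.
have : \det (abelianized phi) * \det (abelianized psi) = 1.
  by rewrite -det_mulmx AB det1.
rewrite aE bE -intrM => /eqP; rewrite -[1]/(1%:~R) eqr_int => /eqP ab.
rewrite -rmorphXn /=.
have /orP[] : (a == 1) || (a == -1)
  by rewrite mulrC in ab; apply: intUnitRing.unitzPl ab.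
  by move=> /eqP->; rewrite expr1n.
by move=> /eqP->; rewrite sqrrN expr1n.
Qed.

(** Schur triangularization, applied to the transpose so that the triangularizing
    basis appears as the columns of Q. *)
Lemma exists_triangular (A : 'M[algC]_r) : (0 < r)%N -> exists Q L : 'M[algC]_r,
  [/\ Q \in unitmx, is_trig_mx L, \det L = \det A & A *m Q = Q *m L^T].
Proof.
move=> r0; have [P /unitarymx_unit Pu] := Schur A^T r0.
rewrite /similar_to conjumx // => Ltrig.
exists P^T, (P *m A^T *m invmx P); split=> //; first by rewrite unitmx_tr.
  rewrite !det_mulmx det_tr mulrAC -det_mulmx mulmxV // det1 mul1r //.
by rewrite !trmx_mul trmxK trmx_inv !mulmxA mulmxV ?unitmx_tr // mul1mx.
Qed.

Lemma magnus_triangular (phi : F -> F) (Q L : 'M[algC]_r) :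
  {morph phi : x y / (x * y)%g} -> abelianized phi *m Q = Q *m L^T ->
  forall k g, magnus Q [:: k] (phi g) = \sum_l L k l * magnus Q [:: l] g.
Proof.
move=> phiM AQ k g.
have magE l x : magnus Q [:: l] x = \sum_i exponent i x * Q i l.
  rewrite (additive_gens (magnusD Q l)); apply: eq_bigr => i _.
  by rewrite magnus_letter.
rewrite magE; under eq_bigr do rewrite exponent_morph // mulr_suml.
under [RHS]eq_bigr do rewrite magE mulr_sumr.
rewrite exchange_big [RHS]exchange_big /=; apply: eq_bigr => i _.
under eq_bigr do rewrite -mulrA.
under [RHS]eq_bigr do rewrite mulrCA.
rewrite -!mulr_sumr; congr (_ * _).
have /matrixP/(_ i k) := AQ; rewrite !mxE => ->.
by apply: eq_bigr => l _; rewrite !mxE mulrC.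
Qed.

Lemma twisted_separation_auto (phi psi : F -> F) : (2 <= r)%N ->
  {morph phi : x y / (x * y)%g} -> {morph psi : x y / (x * y)%g} ->
  (forall g, D 2 (g^-1 * psi (phi g))%g) ->
  exists z : nat -> F, forall k l x d,
    D (2 * r).+1 d -> (phi x * (z k * d) = z l * x)%g -> k = l.
Proof.
move=> r2 phiM psiM psiK.
have [Q [L [Qu Lt LA AQ]]] := exists_triangular (abelianized phi) (ltnW r2).
apply: (twisted_separation r2 Qu phiM (magnus_triangular phiM AQ) Lt).
by rewrite LA; apply: abelianized_det psiK.
Qed.

End Abelianization.
(** * The second derived subgroup in rank two *)

Section RankTwo.
Local Notation F := (free_group 'I_2).
Local Notation gen := (@free_gen 'I_2).
Local Notation D := (dimension_subgroup algC).
Local Notation c := [~ gen ord0, gen ord_max]%g.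

Lemma polarization_gens (f : F -> algC) a b : degree_lt 3 f ->
  polarization f a b = \sum_i \sum_j
    exponent i a * (exponent j b * polarization f (gen i) (gen j)).
Proof.
move=> Pf.
have addl x : {morph polarization f ^~ x : y z / (y * z)%g >-> y + z}.
  move=> y z; rewrite !polarizationEr.
  have Pr : degree_lt 2 (rdiff x f) by have /degree_lt_rdiffP := Pf; apply.
  exact: dim_additive (ltn0Sn 0) (dim1 y) (dim1 z) Pr.
have addr x : {morph polarization f x : y z / (y * z)%g >-> y + z}.
  move=> y z; rewrite !polarizationEl.
  exact: dim_additive (ltn0Sn 0) (dim1 y) (dim1 z) (Pf x).
rewrite (additive_gens (addl b)); apply: eq_bigr => i _.
by rewrite (additive_gens (addr (gen i))) mulr_sumr.
Qed.

(** In rank two the degree 2 part of the free Lie ring is spanned by the bracket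
    of the two generators c, so every element of the commutator subgroup has the
    leading part of a multiple m of c. *)
Lemma derived1_leading w : derived_series F 1 w -> D 2 w /\
  exists m, forall f : F -> algC, degree_lt 3 f ->
    f w - f 1%g = m * (f c - f 1%g).
Proof.
move: w; apply: generated_sub => [|x y [Dx [m mE]] [Dy [n nE]]|x [Dx [m mE]]|].
- by split=> //; exists 0 => f _; rewrite subrr mul0r.
- split; first exact: dimM.
  exists (m + n) => f Pf.
  by rewrite (dim_additive _ Dx Dy) // mE // nE // mulrDl.
- split; first exact: dimV.
  exists (- m) => f Pf; rewrite mulNr -mE //.
  have := dim_additive (ltn0Sn 1) Dx (dimV Dx) Pf.
  by rewrite mulgV subrr => /eqP; rewrite eq_sym addrC addr_eq0 => /eqP.
move=> _ [a _ [b _ <-]].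
split; first exact: dim_commg (dim1 a) (dim1 b).
pose e i j := exponent i a * exponent j b.
exists (e ord0 ord_max - e ord_max ord0) => f Pf.
rewrite !(commutator_leading (dim1 _) (dim1 _) Pf).
rewrite (polarization_gens a b Pf) (polarization_gens b a Pf) /e.
rewrite !big_ord_recl !big_ord0 /=.
have -> : lift ord0 ord0 = ord_max :> 'I_2 by exact: val_inj.
ring.
Qed.

(** Elements of the commutator subgroup lie in the second dimension subgroup,
    whence their commutators lie in the fourth.  Since the leading parts of x
    and y are both proportional to that of c, the bracket of these leading parts
    vanishes as well, which gains one more step. *)
Lemma derived2_sub_dim5 w : derived_series F 2 w -> D 5 w.
Proof.
apply: generated_sub => [|x y|x|]; first exact: dim_one.
- exact: dimM.
- exact: dimV.
move=> _ [x /derived1_leading[Dx [m mE]] [y /derived1_leading[Dy [n nE]] <-]].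
move=> f Pf; apply/eqP; rewrite -subr_eq0 (commutator_leading Dx Dy Pf).
have Dc : D 2 c by apply: (dim_commg (i := 1) (j := 1)); apply: dim1.
have pol u v a b : D 2 u -> D 2 v ->
    (forall g : F -> algC, degree_lt 3 g -> g u - g 1%g = a * (g c - g 1%g)) ->
    (forall g : F -> algC, degree_lt 3 g -> g v - g 1%g = b * (g c - g 1%g)) ->
    polarization f u v = a * b * polarization f c c.
  move=> Du Dv aE bE.
  rewrite polarizationEr aE; last exact: (rdiff_dim (i := 2)).
  rewrite -polarizationEr polarizationEl bE; last exact: (ldiff_dim (i := 2)).
  by rewrite -polarizationEl mulrA.
by rewrite (pol x y m n) // (pol y x n m) // [n * m]mulrC subrr.
Qed.

End RankTwo.

(** * Free solvable groups *)

Lemma free_lift_repr r (N : normal_subgroup (free_group 'I_r))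
    (phi : quotient_group N -> quotient_group N) :
  {morph phi : x y / (x * y)%g} ->
  exists2 Phi : free_group 'I_r -> free_group 'I_r,
    {morph Phi : x y / (x * y)%g} &
    forall g, quotient_map N (Phi g) = phi (quotient_map N g).
Proof.
move=> phiM; pose f k := repr (phi (quotient_map N (free_gen k))).
exists (free_lift f); first exact: free_liftM.
apply: free_morph_eq => [x y|x y|k].
- by rewrite free_liftM quotient_mapM.
- by rewrite quotient_mapM phiM.
- by rewrite free_lift_gen quotient_reprK.
Qed.

(** An automorphism of the quotient lifts to an endomorphism Phi of the free
    group, and so does its inverse; the lifts are inverse to each other modulo N,
    hence on the abelianization.  The elements z k separated in the free group
    modulo the dimension subgroup of index 2r+1 stay separated modulo N. *)
Theorem R_infinity_quotient r (N : normal_subgroup (free_group 'I_r)) :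
  (2 <= r)%N ->
  (forall w, normal_set N w -> dimension_subgroup algC (2 * r).+1 w) ->
  R_infinity (quotient_group N).
Proof.
move=> r2 ND phi [psi phiK psiK]; pose q := quotient_map N.
have phiM : {morph phi : x y / (x * y)%g} by move=> x y; rewrite gmulfM.
have psiM : {morph psi : x y / (x * y)%g}.
  by move=> x y; apply: (can_inj phiK); rewrite phiM !psiK.
have [Phi PhiM PhiE] := free_lift_repr phiM.
have [Psi PsiM PsiE] := free_lift_repr psiM.
have PsiK g : dimension_subgroup algC 2 (g^-1 * Psi (Phi g))%g.
  have /quotient_mapP/asboolP/ND : q g = q (Psi (Phi g)).
    by rewrite /q PsiE PhiE phiK.
  by apply: dim_leq; lia.
have [z sep] := twisted_separation_auto r2 PhiM PsiM PsiK.
pose cl k := twisted_class phi (q (z k)).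
have cl_inj : injective cl.
  move=> k l kl; have : cl k (q (z k)) by apply: twisted_conjugate_refl.
  rewrite kl => -[x]; elim/quotient_ind: x => y.
  rewrite -PhiE -!quotient_mapM => /quotient_mapP/asboolP/ND Dd.
  by apply: (sep k l y _ Dd); rewrite mulgA mulVKg.
move=> fin; apply: infinite_nat.
have := finite_preimage (in2W cl_inj) fin.
suff -> : (cl @^-1` twisted_classes phi)%classic = setT by [].
by apply/seteqP; split=> // k _; exists (q (z k)).
Qed.

Lemma log2_le (R : realType) n t :
  (0 < n)%N -> log2 n%:R <= t%:R :> R -> (n <= 2 ^ t)%N.
Proof.
move=> n0; rewrite /log2 ler_pdivrMr; last by rewrite ln_gt0 // ltr1n.
rewrite mulr_natl -lnXn // ler_ln ?posrE ?ltr0n ?exprn_gt0 //.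
by rewrite -natrX ler_nat.
Qed.

Theorem theorem2 :
  ((forall t : nat, (2 <= t)%N -> R_infinity (free_solvable 2 t)) /\
   R_infinity (free_solvable 2 2)) /\
  (forall t : nat, (4 <= t)%N -> R_infinity (free_solvable 3 t)) /\
  (forall (R : realType) (r t : nat), (4 <= r)%N ->
     (log2 (2 * r + 1)%N%:R <= t%:R :> R)%R ->
     R_infinity (free_solvable r t)).
Proof.
have large r t : (2 <= r)%N -> (2 * r + 1 <= 2 ^ t)%N ->
    R_infinity (free_solvable r t).
  move=> r2 rt; apply: R_infinity_quotient => // w Dw.
  by apply: dim_leq (derived_sub_dim Dw); rewrite -addn1.
have rank2 t : (2 <= t)%N -> R_infinity (free_solvable 2 t).
  move=> t2; apply: R_infinity_quotient => // w.
  by move/(derived_series_leq t2)/derived2_sub_dim5.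
split; first by split=> //; apply: rank2.
split=> [t t4|R r t r4 /log2_le rt]; apply: large => //.
- by apply: leq_trans (leq_pexp2l _ t4).
- by apply: ltnW; apply: ltnW.
- by apply: rt; rewrite addn1.
Qed.
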